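(* Let $t\in\mathbb{C}$ be a $6$th root of unity, $T\in\{e^{2\pi i/3},e^{-2\pi i/3}\}$, $\omega\in\{e^{i\pi/3},e^{-i\pi/3}\}$, and let $c,d\in\mathbb{C}$ satisfy $d\neq0$, $c\neq0$ and $c\neq\omega d^2$; put $a=\omega d$. Let $\rho=\rho(T,t,a,c,d):\mathcal{NB}_3\to GL(2,\mathbb{C})$ be the corresponding irreducible representation of the necklace braid group $\mathcal{NB}_3$. Then there exists a hermitian positive definite matrix $M$ such that $\rho$ is unitary relative to $M$ if and only if $|d|<1$ and $$c=\frac{\omega d(|d|^2-1)}{\bar d}.$$
   Context: The necklace braid group $\mathcal{NB}_n$ is the group with generators $\sigma_1,\dots,\sigma_n,\tau$ and relations (indices taken modulo $n$, so $\sigma_{n+1}=\sigma_1$): $\sigma_i\sigma_{i+1}\sigma_i=\sigma_{i+1}\sigma_i\sigma_{i+1}$; $\sigma_i\sigma_j=\sigma_j\sigma_i$ whenever $i-j\not\equiv\pm1 \pmod n$; $\tau\sigma_i\tau^{-1}=\sigma_{i+1}$; $\tau^{2n}=1$. For the parameters considered, $\rho(T,t,a,c,d)$ denotes the representation of $\mathcal{NB}_n$ on $\mathbb{C}^2$ with $\tau\mapsto\begin{pmatrix}Tt&0\\0&t\end{pmatrix}$ and $\sigma_j\mapsto\begin{pmatrix}a&T^{j-1}\\ cT^{1-j}&d\end{pmatrix}$ for $1\le j\le n$ (here $n=3$). A square matrix $A$ is unitary relative to a matrix $M$ if $AMA^*=M$, where $A^*$ is the conjugate transpose of $A$. A representation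 $\rho$ of a group $G$ is unitary relative to $M$ if $\rho(g)$ is unitary relative to $M$ for every $g\in G$. *)

(* Defs.v *)
From HB Require Import structures.
From mathcomp Require Import all_boot all_order all_algebra sesquilinear spectral.
From mathcomp Require Import boolp reals trigo complex.
From mathcomp Require Import ring lra.
Set Implicit Arguments.
Unset Strict Implicit.
Unset Printing Implicit Defensive.
Import Order.TTheory GRing.Theory Num.Theory.
Local Open Scope ring_scope.
Local Open Scope quotient_scope.

Notation "{ 'ghom' G -> H }" := (monoid.UMagmaMorphism.type G%type H%type)
  (at level 0, G at level 98, H at level 99,
   format "{ 'ghom'  G  ->  H }") : type_scope.

(* The letter (x, true) stands for the generator x and (x, false) for its
   inverse. *)
Definition word (X : Type) := seq (X * bool).

Inductive pres_cong (X : Type) (rels : word X -> word X -> Prop) :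
    word X -> word X -> Prop :=
| pres_refl u : pres_cong rels u u
| pres_sym u v : pres_cong rels u v -> pres_cong rels v u
| pres_trans v u w :
    pres_cong rels u v -> pres_cong rels v w -> pres_cong rels u w
| pres_cancel u v x b :
    pres_cong rels (u ++ [:: (x, b); (x, ~~ b)] ++ v) (u ++ v)
| pres_rel u v r s : rels r s -> pres_cong rels (u ++ r ++ v) (u ++ s ++ v).

Section Presentation.
Variables (X : choiceType) (rels : word X -> word X -> Prop).
Local Notation cong := (pres_cong rels).

Definition pres_eqb (u v : word X) : bool := `[< cong u v >].

Lemma pres_eqb_refl : reflexive pres_eqb.
Proof. by move=> u; apply/asboolP; apply: pres_refl. Qed.

Lemma pres_eqb_sym : symmetric pres_eqb.
Proof. by move=> u v; apply/asboolP/asboolP; apply: pres_sym. Qed.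

Lemma pres_eqb_trans : transitive pres_eqb.
Proof.
by move=> v u w /asboolP uv /asboolP vw; apply/asboolP; apply: pres_trans uv vw.
Qed.

Canonical pres_equiv :=
  EquivRel pres_eqb pres_eqb_refl pres_eqb_sym pres_eqb_trans.

Definition presented := {eq_quot pres_equiv}.
HB.instance Definition _ := Choice.on presented.
HB.instance Definition _ := EqQuotient.on presented.

Definition pres_class (w : word X) : presented := \pi_presented w.

Lemma pres_classP u v : pres_class u = pres_class v <-> cong u v.
Proof.
split; first by move=> /eqmodP /asboolP.
by move=> uv; apply/eqmodP/asboolP.
Qed.

Lemma pres_classK (x : presented) : pres_class (repr x) = x.
Proof. exact: reprK. Qed.

Definition word_inv (w : word X) : word X := rev [seq (l.1, ~~ l.2) | l <- w].

Lemma cong_ctx p q u v : cong u v -> cong (p ++ u ++ q) (p ++ v ++ q).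
Proof.
elim=> {u v} [u|u v _ IH|v u w _ IHu _ IHw|u v x b|u v r s rs].
- exact: pres_refl.
- exact: pres_sym.
- exact: pres_trans IHu IHw.
- have := pres_cancel rels (p ++ u) (v ++ q) x b.
  by rewrite -!catA.
- have := pres_rel (p ++ u) (v ++ q) rs.
  by rewrite -!catA.
Qed.

Lemma cong_cat u u' v v' : cong u u' -> cong v v' -> cong (u ++ v) (u' ++ v').
Proof.
move=> uu' vv'; apply: (pres_trans (v := u' ++ v)).
  by have := cong_ctx [::] v uu'.
by have := cong_ctx u' [::] vv'; rewrite !cats0.
Qed.

Lemma word_inv_cat u v : word_inv (u ++ v) = word_inv v ++ word_inv u.
Proof. by rewrite /word_inv map_cat rev_cat. Qed.

Lemma word_invK : involutive word_inv.
Proof.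
move=> w; rewrite /word_inv map_rev revK -map_comp -[RHS]map_id.
by apply: eq_map => -[x b] /=; rewrite negbK.
Qed.

Lemma cong_mulwV w : cong (w ++ word_inv w) [::].
Proof.
elim: w => [|[x b] w IH]; first exact: pres_refl.
rewrite -cat1s word_inv_cat catA -(catA [:: _]).
apply: (pres_trans (v := [:: (x, b)] ++ [::] ++ word_inv [:: (x, b)])).
  by have := cong_ctx [:: (x, b)] (word_inv [:: (x, b)]) IH; rewrite -?catA.
exact: (pres_cancel rels [::] [::] x b).
Qed.

Lemma cong_mulVw w : cong (word_inv w ++ w) [::].
Proof. by rewrite -{2}(word_invK w); apply: cong_mulwV. Qed.

Lemma cong_inv u v : cong u v -> cong (word_inv u) (word_inv v).
Proof.
move=> uv.
apply: (pres_trans (v := word_inv u ++ (v ++ word_inv v))).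
  rewrite -{1}[word_inv u]cats0; apply: cong_cat; first exact: pres_refl.
  by apply: pres_sym; apply: cong_mulwV.
rewrite catA -[X in cong _ X]cat0s; apply: cong_cat; last exact: pres_refl.
apply: (pres_trans (v := word_inv u ++ u)); last exact: cong_mulVw.
by apply: cong_cat; [apply: pres_refl | apply: pres_sym].
Qed.

Definition pres_one : presented := pres_class [::].
Definition pres_mul (x y : presented) : presented :=
  pres_class (repr x ++ repr y).
Definition pres_inv (x : presented) : presented :=
  pres_class (word_inv (repr x)).

Lemma cong_repr w : cong (repr (pres_class w)) w.
Proof. by apply/pres_classP; rewrite pres_classK. Qed.

Lemma pres_mulE u v :
  pres_mul (pres_class u) (pres_class v) = pres_class (u ++ v).
Proof. by apply/pres_classP/cong_cat; apply: cong_repr. Qed.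

Lemma pres_invE u : pres_inv (pres_class u) = pres_class (word_inv u).
Proof. by apply/pres_classP/cong_inv/cong_repr. Qed.

Lemma pres_mulA : associative pres_mul.
Proof.
move=> x y z.
by rewrite -(pres_classK x) -(pres_classK y) -(pres_classK z) !pres_mulE catA.
Qed.

Lemma pres_mul1 : left_id pres_one pres_mul.
Proof. by move=> x; rewrite -(pres_classK x) pres_mulE. Qed.

Lemma pres_mulr1 : right_id pres_one pres_mul.
Proof. by move=> x; rewrite -(pres_classK x) pres_mulE cats0. Qed.

Lemma pres_mulV : left_inverse pres_one pres_inv pres_mul.
Proof.
move=> x; rewrite -(pres_classK x) pres_invE pres_mulE.
exact/pres_classP/cong_mulVw.
Qed.

Lemma pres_mulrV : right_inverse pres_one pres_inv pres_mul.
Proof.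
move=> x; rewrite -(pres_classK x) pres_invE pres_mulE.
exact/pres_classP/cong_mulwV.
Qed.

HB.instance Definition _ :=
  isGroup.Build presented pres_mulA pres_mul1 pres_mulr1 pres_mulV pres_mulrV.

Definition pres_gen (x : X) : presented := pres_class [:: (x, true)].

Lemma pres_class_cons x b w :
  pres_class ((x, b) :: w) =
  ((if b then pres_gen x else (pres_gen x)^-1) * pres_class w)%g.
Proof.
have -> : (if b then pres_gen x else (pres_gen x)^-1)%g = pres_class [:: (x, b)].
  by case: b => //; apply: pres_invE.
by symmetry; apply: pres_mulE.
Qed.

Lemma pres_ind (P : presented -> Prop) :
  P 1%g -> (forall x g, P g -> P (pres_gen x * g)%g) ->
  (forall x g, P g -> P ((pres_gen x)^-1 * g)%g) -> forall g, P g.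
Proof.
move=> P1 PM PV g; rewrite -(pres_classK g); elim: (repr g) => [|[x b] w IH] //.
by rewrite pres_class_cons; case: b; [apply: PM | apply: PV].
Qed.

Section Lift.
Variables (H : groupType) (f : X -> H).

Fixpoint word_eval (w : word X) : H :=
  if w is (x, b) :: w' then ((if b then f x else (f x)^-1) * word_eval w')%g
  else 1%g.

Lemma word_eval_cat u v : word_eval (u ++ v) = (word_eval u * word_eval v)%g.
Proof.
by elim: u => [|[x b] u IH] /=; rewrite ?mul1g // IH mulgA.
Qed.

Hypothesis f_rels : forall r s, rels r s -> word_eval r = word_eval s.

Lemma word_eval_cong u v : cong u v -> word_eval u = word_eval v.
Proof.
elim=> {u v} // [v u w _ -> _ -> //|u v x b|u v r s /f_rels rs].
- rewrite !word_eval_cat /= mulg1; congr (_ * _)%g.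
  by case: b; rewrite /= ?(mulgV, mulVg) mul1g.
- by rewrite !word_eval_cat rs.
Qed.

Definition pres_lift (g : presented) : H := word_eval (repr g).

Lemma pres_liftE w : pres_lift (pres_class w) = word_eval w.
Proof. exact/word_eval_cong/cong_repr. Qed.

Lemma pres_liftM : {morph pres_lift : x y / (x * y)%g}.
Proof.
move=> x y; rewrite -(pres_classK x) -(pres_classK y).
rewrite [(_ * _)%g in LHS](_ : _ = pres_class (repr x ++ repr y)); last first.
  exact: pres_mulE.
by rewrite !pres_liftE word_eval_cat.
Qed.

Lemma pres_lift_exists :
  exists phi : {ghom presented -> H}, forall x, phi (pres_gen x) = f x.
Proof.
pose m := monoid.isUMagmaMorphism.Build presented H pres_lift
  (pres_liftE [::], pres_liftM).
pose phi : {ghom presented -> H} := HB.pack pres_lift m.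
by exists phi => x; rewrite [phi _]pres_liftE /= mulg1.
Qed.

End Lift.
End Presentation.

(* None stands for tau and Some i, with i : 'I_n, for sigma_(i + 1), so that
   ordS is the shift of indices modulo n. *)
Inductive necklace_rel (n : nat) :
    word (option 'I_n) -> word (option 'I_n) -> Prop :=
| necklace_braid (i : 'I_n) : necklace_rel
    [:: (Some i, true); (Some (ordS i), true); (Some i, true)]
    [:: (Some (ordS i), true); (Some i, true); (Some (ordS i), true)]
| necklace_far (i j : 'I_n) : i != ordS j -> j != ordS i -> necklace_rel
    [:: (Some i, true); (Some j, true)] [:: (Some j, true); (Some i, true)]
| necklace_rot (i : 'I_n) : necklace_rel
    [:: (None, true); (Some i, true); (None, false)] [:: (Some (ordS i), true)]
| necklace_tau : necklace_rel (nseq (2 * n) (None, true)) [::].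

Definition necklace_braid_group (n : nat) := presented (@necklace_rel n).

HB.instance Definition _ n := monoid.Group.on (necklace_braid_group n).

Definition nb_tau {n : nat} : necklace_braid_group n := pres_gen _ None.
Definition nb_sigma {n : nat} (i : 'I_n) : necklace_braid_group n :=
  pres_gen _ (Some i).

Section GeneralLinear.
Variables (F : fieldType) (n : nat).

(* 'GL_n[F] is only available in the library for a finite F. *)
Record GL := MkGL { GL_mx :> 'M[F]_n; GL_unit : GL_mx \in unitmx }.
HB.instance Definition _ := [isSub for GL_mx].
HB.instance Definition _ := [Choice of GL by <:].

Definition GL_one : GL := MkGL (unitmx1 F n).
Lemma GL_mul_subproof (A B : GL) : A *m B \in unitmx.
Proof. by rewrite unitmx_mul !GL_unit. Qed.
Definition GL_mul (A B : GL) : GL := MkGL (GL_mul_subproof A B).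
Lemma GL_inv_subproof (A : GL) : invmx A \in unitmx.
Proof. by rewrite unitmx_inv GL_unit. Qed.
Definition GL_inv (A : GL) : GL := MkGL (GL_inv_subproof A).

Lemma GL_mulA : associative GL_mul.
Proof. by move=> A B C; apply: val_inj; apply: mulmxA. Qed.
Lemma GL_mul1 : left_id GL_one GL_mul.
Proof. by move=> A; apply: val_inj; apply: mul1mx. Qed.
Lemma GL_mulr1 : right_id GL_one GL_mul.
Proof. by move=> A; apply: val_inj; apply: mulmx1. Qed.
Lemma GL_mulV : left_inverse GL_one GL_inv GL_mul.
Proof. by move=> A; apply: val_inj; apply: mulVmx; apply: GL_unit. Qed.
Lemma GL_mulrV : right_inverse GL_one GL_inv GL_mul.
Proof. by move=> A; apply: val_inj; apply: mulmxV; apply: GL_unit. Qed.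

HB.instance Definition _ :=
  isGroup.Build GL GL_mulA GL_mul1 GL_mulr1 GL_mulV GL_mulrV.

Lemma GL_mxM (A B : GL) : (A * B)%g = A *m B :> 'M_n.
Proof. by []. Qed.

Lemma GL_mx1 : (1%g : GL) = 1%:M :> 'M_n.
Proof. by []. Qed.

Lemma GL_mxV (A : GL) : (A^-1)%g = invmx A :> 'M_n.
Proof. by []. Qed.

Lemma GL_mx_inj : injective GL_mx.
Proof. exact: val_inj. Qed.

End GeneralLinear.

(* The space is 'cV[F]_n, on which G acts by left multiplication. *)
Definition irreducible_repr (G : groupType) (F : fieldType) (n : nat)
    (rho : {ghom G -> GL F n}) : Prop :=
  (0 < n)%N /\
  forall U : {vspace 'cV[F]_n},
    (forall g v, v \in U -> (rho g : 'M_n) *m v \in U) ->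
    U = 0%VS \/ U = fullv.

Section Unitarity.
Local Open Scope sesquilinear_scope.
Variables (C : numClosedFieldType) (n : nat).

Definition unitary_rel (M A : 'M[C]_n) : Prop := A *m M *m A ^t* = M.

Definition unitary_repr_rel (G : groupType)
    (rho : {ghom G -> GL C n}) (M : 'M[C]_n) : Prop :=
  forall g : G, unitary_rel M (rho g).

(* In C, 0 < z says that z is real and positive. *)
Definition hermitian_posdef (M : 'M[C]_n) : Prop :=
  M \is hermsymmx /\
  forall v : 'cV[C]_n, v != 0 -> 0 < (v ^t* *m M *m v) 0 0.

End Unitarity.

Definition mx2 (F : fieldType) (a b c d : F) : 'M[F]_2 :=
  \matrix_(i, j) if i == 0 then (if j == 0 then a else b)
                 else (if j == 0 then c else d).

(* As i : 'I_n stands for the index j = i + 1, T ^+ i and T ^- i are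
   T^(j - 1) and T^(1 - j). *)
Definition is_rho (n : nat) (F : fieldType) (T t a c d : F)
    (rho : {ghom necklace_braid_group n -> GL F 2}) : Prop :=
  rho nb_tau = mx2 (T * t) 0 0 t :> 'M_2 /\
  forall i : 'I_n, rho (nb_sigma i) = mx2 a (T ^+ i) (c * T ^- i) d :> 'M_2.

(* exp(ix), by Euler's formula *)
Definition expi (R : realType) (x : R) : R[i] := Complex (cos x) (sin x).

Lemma mx2M (F : fieldType) (a b c d a' b' c' d' : F) :
  mx2 a b c d *m mx2 a' b' c' d' =
  mx2 (a * a' + b * c') (a * b' + b * d') (c * a' + d * c') (c * b' + d * d').
Proof.
apply/matrixP => i j; rewrite !mxE big_ord_recl big_ord1 !mxE /=.
by case: i j => [[|[|]]] // ? [[|[|]]].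
Qed.

Lemma mx2_1 (F : fieldType) : 1%:M = mx2 1 0 0 1 :> 'M[F]_2.
Proof.
by apply/matrixP => i j; rewrite !mxE; case: i j => [[|[|]]] // ? [[|[|]]].
Qed.

Lemma det_mx2 (F : fieldType) (a b c d : F) : \det (mx2 a b c d) = a * d - b * c.
Proof.
rewrite (expand_det_row _ 0) big_ord_recl big_ord1 /cofactor !det_mx11 !mxE /=.
by rewrite expr0 expr1 mul1r mulN1r mulrN.
Qed.

Lemma is_rho_unique n (F : fieldType) (T t a c d : F)
    (rho rho' : {ghom necklace_braid_group n -> GL F 2}) :
  is_rho T t a c d rho -> is_rho T t a c d rho' -> rho =1 rho'.
Proof.
move=> [tauE sigE] [tauE' sigE'].
have gE x : rho (pres_gen _ x) = rho' (pres_gen _ x).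
  by apply: val_inj; case: x => [i|]; rewrite /= ?sigE ?sigE' ?tauE ?tauE'.
apply: pres_ind => [|x g gg|x g gg]; first by rewrite !gmulf1.
  by rewrite !gmulfM gE gg.
by rewrite !gmulfM !gmulfV gE gg.
Qed.

Section RhoThree.
Variable F : fieldType.
Variables T t w c d : F.
Hypotheses (Tp : T ^+ 2 + T + 1 = 0) (t6 : t ^+ 6 = 1).
Hypotheses (wp : w ^+ 2 - w + 1 = 0) (cd : c != w * d ^+ 2).

Let T3 : T ^+ 3 = 1.
Proof.
have -> : T ^+ 3 = (T ^+ 2 + T + 1) * (T - 1) + 1 by ring.
by rewrite Tp mul0r add0r.
Qed.

Let T_neq0 : T != 0.
Proof. by apply/eqP => T0; have /eqP := T3; rewrite T0 expr0n eq_sym oner_eq0. Qed.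

Let t_neq0 : t != 0.
Proof. by apply/eqP => t0; have /eqP := t6; rewrite t0 expr0n eq_sym oner_eq0. Qed.

Let T_ordS (i : 'I_3) : T ^+ (i.+1 %% 3) = T * T ^+ i.
Proof. by case: i => [[|[|[|]]]] //= _; rewrite -exprS ?T3 ?expr0. Qed.

Lemma rho_exists : exists rho : {ghom necklace_braid_group 3 -> GL F 2},
  is_rho T t (w * d) c d rho.
Proof.
have T0 := T_neq0; have t0 := t_neq0.
have tauU : mx2 (T * t) 0 0 t \in unitmx.
  by rewrite unitmxE det_mx2 mulr0 subr0 unitfE !mulf_neq0.
have sigU (i : 'I_3) : mx2 (w * d) (T ^+ i) (c * T ^- i) d \in unitmx.
  rewrite unitmxE det_mx2 unitfE mulrCA mulfV ?expf_neq0 // mulr1 subr_eq0.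
  by rewrite eq_sym -mulrA -expr2.
pose f x : GL F 2 := if x is Some i then MkGL (sigU i) else MkGL tauU.
have f_rels r s : necklace_rel r s -> word_eval f r = word_eval f s.
  case=> {r s} [i|i j ij ji|i|]; apply: GL_mx_inj.
  - rewrite /= !mulmx1 T_ordS !mx2M invfM.
    have := expf_neq0 i T0; set z := T ^+ i => z0.
    have wE : w ^+ 2 = w - 1 by apply/eqP; rewrite -subr_eq0 -wp; apply/eqP; ring.
    by congr (mx2 _ _ _ _); field: wE T3; rewrite ?z0 ?T0.
  - by case: i j ij ji => [[|[|[|]]]] //= ? [[|[|[|]]]].
  - rewrite /= !mulmx1 T_ordS mulmxA.
    apply: (canLR (mulmxK tauU)); rewrite !mx2M.
    by congr (mx2 _ _ _ _); field; rewrite ?expf_neq0 ?T0 ?t0.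
  - rewrite (_ : 2 * 3 = 6)%N //= mulmx1 !mx2M mx2_1.
    rewrite !(mul0r, mulr0, addr0, add0r).
    by congr (mx2 _ _ _ _); ring: t6 T3.
have [phi phiE] := pres_lift_exists f_rels.
by exists phi; split=> [|i]; rewrite /nb_tau /nb_sigma phiE.
Qed.

Lemma rho_irreducible (a : F) (rho : {ghom necklace_braid_group 3 -> GL F 2}) :
  T != 1 -> c != 0 -> is_rho T t a c d rho -> irreducible_repr rho.
Proof.
move=> T1 c0 [tauE sigE]; split=> // U Ustable.
have [->|U0] := eqVneq U 0%VS; [by left | right].
have mulE p q r s (v : 'cV[F]_2) : mx2 p q r s *m v =
    (p * v 0 0 + q * v 1 0) *: delta_mx 0 0 +
    (r * v 0 0 + s * v 1 0) *: delta_mx 1 0.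
  apply/matrixP => i j; rewrite !mxE big_ord_recl big_ord1 !mxE (ord1 j).
  have -> : lift ord0 ord0 = 1 :> 'I_2 by apply: val_inj.
  by case: i => [[|[|]]] //= ?; rewrite ?mulr1 ?mulr0 ?addr0 ?add0r.
have vE (v : 'cV[F]_2) : v = v 0 0 *: delta_mx 0 0 + v 1 0 *: delta_mx 1 0.
  by rewrite -{1}[v]mul1mx mx2_1 mulE !(mul1r, mul0r, addr0, add0r).
have tauU v : v \in U -> mx2 (T * t) 0 0 t *m v \in U.
  by rewrite -tauE; apply: Ustable.
have sigU v : v \in U -> mx2 a 1 c d *m v \in U.
  have -> : mx2 a 1 c d = rho (nb_sigma 0) by rewrite sigE expr0 invr1 mulr1.
  exact: Ustable.
have scal x (v : 'cV[F]_2) : x != 0 -> x *: v \in U -> v \in U.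
  by move=> x0 xv; rewrite -[v](scalerK x0) memvZ.
have e0U_e1U : delta_mx 0 0 \in U -> delta_mx 1 0 \in U.
  move=> e0U; have := sigU _ e0U; rewrite mulE !mxE /= !(mulr1, mulr0, addr0).
  by rewrite rpredDl ?(memvZ _ e0U) //; exact: (@scal _ _ c0).
have e1U_e0U : delta_mx 1 0 \in U -> delta_mx 0 0 \in U.
  move=> e1U; have := sigU _ e1U; rewrite mulE !mxE /= !(mulr1, mulr0, add0r).
  by rewrite rpredDr ?(memvZ _ e1U) // scale1r.
suff [e0U e1U] : delta_mx 0 0 \in U /\ delta_mx 1 0 \in U.
  apply/eqP; rewrite eqEsubv subvf; apply/subvP => v _.
  by rewrite (vE v) memvD ?memvZ.
suff : delta_mx 0 0 \in U \/ delta_mx 1 0 \in U by case=> eU; split; auto.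
have vU := memv_pick U; have v0 : vpick U != 0 by rewrite vpick0.
have [v00|v00] := eqVneq (vpick U 0 0) 0.
  right; apply: (@scal (vpick U 1 0)).
    by apply: contraNneq v0 => v10; rewrite (vE (vpick U)) v00 v10 !scale0r addr0.
  by move: vU; rewrite {1}(vE (vpick U)) v00 scale0r add0r.
left; apply: (@scal ((T - 1) * t * vpick U 0 0)).
  by rewrite !mulf_neq0 ?subr_eq0.
have := memvB (tauU _ vU) (memvZ t vU).
rewrite mulE [X in _ - t *: X]vE !(mul0r, addr0, add0r) scalerDr !scalerA.
by rewrite opprD addrACA subrr addr0 -scalerBl mulrBl mulrBl mul1r.
Qed.
End RhoThree.

Section Expi.
Variable R : realType.
Implicit Types x y : R.

Lemma expiD x y : expi (x + y) = expi x * expi y.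
Proof.
rewrite /expi cosD sinD; apply/eqP; rewrite eq_complex /= eqxx /=.
by rewrite addrC.
Qed.

Lemma expi_pi3 (w : R[i]) :
  w = expi (pi / 3) \/ w = expi (- (pi / 3)) -> w ^+ 2 - w + 1 = 0.
Proof.
move=> wE; have p0 := pi_gt0 R.
have w3 : w ^+ 3 = -1.
  rewrite !exprS expr0 mulr1; case: wE => ->; rewrite -!expiD.
    rewrite (_ : _ + _ = pi); last by field.
    by apply/eqP; rewrite eq_complex /= cospi sinpi oppr0 !eqxx.
  rewrite (_ : _ + _ = - pi); last by field.
  by apply/eqP; rewrite eq_complex /= cosN sinN cospi sinpi oppr0 !eqxx.
have w1 : w + 1 != 0.
  have c0 : 0 < cos (pi / 3 : R) by apply: cos_gt0_pihalf; apply/andP; split; lra.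
  apply/eqP => /(congr1 (@complex.Re R)); case: wE => -> /=; rewrite ?cosN; lra.
by apply: (mulfI w1); rewrite mulr0 -(subrr (-1)) -{1}w3; ring.
Qed.

Lemma expi_2pi3 (T : R[i]) :
  T = expi (2 * pi / 3) \/ T = expi (- (2 * pi / 3)) ->
  T ^+ 2 + T + 1 = 0.
Proof.
move=> TE.
have [w [wE ->]] : exists w : R[i],
    (w = expi (pi / 3) \/ w = expi (- (pi / 3))) /\ T = w ^+ 2.
  case: TE => ->; [exists (expi (pi / 3)) | exists (expi (- (pi / 3)))];
    by split; auto; rewrite expr2 -expiD; congr expi; field.
have w0 := expi_pi3 wE.
rewrite (_ : _ + 1 = (w ^+ 2 + w + 1) * (w ^+ 2 - w + 1)); last by ring.
by rewrite w0 mulr0.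
Qed.

End Expi.

(* A homomorphism satisfying is_rho is unique by is_rho_unique. For n = 3 and
   the parameters of rho3_exists it exists, and it is irreducible as soon as
   c != 0. *)
Lemma rho3_exists (R : realType) (t T w c d : R[i]) :
  6.-unity_root t ->
  T = expi (2 * pi / 3) \/ T = expi (- (2 * pi / 3)) ->
  w = expi (pi / 3) \/ w = expi (- (pi / 3)) ->
  c != w * d ^+ 2 ->
  exists rho : {ghom necklace_braid_group 3 -> GL R[i] 2},
    is_rho T t (w * d) c d rho.
Proof.
move=> /unity_rootP t6 /expi_2pi3 T0 /expi_pi3 w0 cd; exact: rho_exists.
Qed.

Lemma rho3_irreducible (R : realType) (t T a c d : R[i])
    (rho : {ghom necklace_braid_group 3 -> GL R[i] 2}) :
  6.-unity_root t ->
  T = expi (2 * pi / 3) \/ T = expi (- (2 * pi / 3)) ->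
  c != 0 -> is_rho T t a c d rho -> irreducible_repr rho.
Proof.
move=> /unity_rootP t6 /expi_2pi3 T0 c0; apply: rho_irreducible => //.
apply: contra_eqN T0 => /eqP ->.
by rewrite expr1n (_ : _ + 1 = 3%:R) ?pnatr_eq0 //; ring.
Qed.

(* Main.v *)
Require Import Defs.
From mathcomp Require Import all_boot all_order all_algebra sesquilinear spectral.
From mathcomp Require Import boolp reals trigo complex.
From mathcomp Require Import ring.
Import Order.TTheory GRing.Theory Num.Theory.
Local Open Scope ring_scope.

(* As the eigenvalues of the image of tau are distinct of modulus 1, an
   invariant hermitian form is diagonal, say diag(p, q). Invariance under the
   image of sigma_1 is then a system of three equations, which says that
   q = p (1 - |d|^2) and c = w d (|d|^2 - 1) / d^*; the other sigma_j give the
   same system because |T| = 1. *)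

Lemma mx2_eta (F : fieldType) (M : 'M[F]_2) :
  M = mx2 (M 0 0) (M 0 1) (M 1 0) (M 1 1).
Proof.
apply/matrixP => i j; rewrite !mxE.
by case: i j => [[|[|]]] // ? [[|[|]]] // ? /=; congr (M _ _); apply: val_inj.
Qed.

Lemma mx2_inj (F : fieldType) (a b c d a' b' c' d' : F) :
  mx2 a b c d = mx2 a' b' c' d' -> [/\ a = a', b = b', c = c' & d = d'].
Proof.
move=> /matrixP E.
by split; [have := E 0 0 | have := E 0 1 | have := E 1 0 | have := E 1 1];
  rewrite !mxE.
Qed.

Section Unitary.
Local Open Scope sesquilinear_scope.
Variable C : numClosedFieldType.

Lemma mx2_adj (a b c d : C) : (mx2 a b c d) ^t* = mx2 a^* c^* b^* d^*.
Proof.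
apply/matrixP => i j; rewrite !mxE.
by case: i j => [[|[|]]] // ? [[|[|]]].
Qed.

Lemma unitary_rel_mul n (M A B : 'M[C]_n) :
  unitary_rel M A -> unitary_rel M B -> unitary_rel M (A *m B).
Proof.
move=> AM BM; rewrite /unitary_rel trmx_mul map_mxM -{2}AM -{2}BM.
by rewrite !mulmxA.
Qed.

Lemma unitary_rel_inv n (M A : 'M[C]_n) : A \in unitmx ->
  unitary_rel M A -> unitary_rel M (invmx A).
Proof.
move=> uA AM; rewrite /unitary_rel -{1}AM !mulmxA mulVmx // mul1mx -mulmxA.
by rewrite -map_mxM -trmx_mul mulVmx // trmx1 map_mx1 mulmx1.
Qed.

(** Invertible matrices unitary relative to [M] are closed under products and inverses, so induction
    on words reduces unitarity to the generators. *)
Lemma unitary_repr_rel_presented n (X : choiceType)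
    (rels : word X -> word X -> Prop) (rho : {ghom presented rels -> GL C n})
    (M : 'M[C]_n) :
  unitary_repr_rel rho M <-> forall x, unitary_rel M (rho (pres_gen rels x)).
Proof.
split=> [MU x|MU]; first exact: MU.
apply: (pres_ind (P := fun g => unitary_rel M (rho g))) => [|x g gU|x g gU].
- by rewrite gmulf1 /unitary_rel GL_mx1 mul1mx trmx1 map_mx1 mulmx1.
- by rewrite gmulfM; apply: unitary_rel_mul; [apply: MU|].
- rewrite gmulfM gmulfV; apply: unitary_rel_mul => //.
  by rewrite GL_mxV; apply: unitary_rel_inv; [apply: Defs.GL_unit | apply: MU].
Qed.

Lemma hermitian_posdef_diag n (M : 'M[C]_n) (i : 'I_n) :
  hermitian_posdef M -> 0 < M i i.
Proof.
case=> _ /(_ (delta_mx i 0)).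
rewrite trmx_delta map_delta_mx -rowE -colE !mxE; apply.
by apply/eqP => /matrixP/(_ i 0)/eqP; rewrite !mxE !eqxx oner_eq0.
Qed.

(** The form is p |v_0|^2 + q |v_1|^2, a sum of nonnegative terms that both vanish only at v = 0. *)
Lemma hermitian_posdef_mx2 (p q : C) :
  0 < p -> 0 < q -> hermitian_posdef (mx2 p 0 0 q).
Proof.
move=> p0 q0; split.
  apply/is_hermitianmxP; rewrite expr0 scale1r mx2_adj conjC0.
  by rewrite !(CrealP _) // gtr0_real.
move=> v v0.
have -> : (v ^t* *m mx2 p 0 0 q *m v) 0 0 =
    p * `|v 0 0| ^+ 2 + q * `|v 1 0| ^+ 2.
  rewrite !normCK -mulmxA !mxE !big_ord_recl !big_ord0 !mxE !big_ord_recl.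
  rewrite !big_ord0 !mxE /=.
  have -> : lift ord0 ord0 = 1 :> 'I_2 by apply: val_inj.
  ring.
have nn (x y : C) : 0 < x -> 0 <= x * `|y| ^+ 2.
  by move=> x0; rewrite mulr_ge0 ?exprn_ge0 // ltW.
rewrite lt0r addr_ge0 ?nn // andbT paddr_eq0 ?nn //.
rewrite !mulf_eq0 !orbb !normr_eq0 (gt_eqF p0) (gt_eqF q0) /=.
apply: contraNN v0 => /andP[/eqP v00 /eqP v10].
apply/eqP/matrixP => i j; rewrite (ord1 j) mxE.
case: i => [[|[|]]] // lti.
  by rewrite -{}v00; congr (v _ _); apply: val_inj.
by rewrite -{}v10; congr (v _ _); apply: val_inj.
Qed.

(** Invariance at the entry (0, 1) reads x M_01 y^* = M_01. Multiplying by y, whose inverse is y^*,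
    gives (x - y) M_01 = 0. *)
Lemma unitary_rel_diag_offdiag (M : 'M[C]_2) (x y : C) :
  `|y| = 1 -> x != y -> unitary_rel M (mx2 x 0 0 y) -> M 0 1 = 0.
Proof.
move=> y1 xy; rewrite /unitary_rel {1 2}(mx2_eta _ M) mx2_adj !mx2M conjC0.
case/mx2_inj=> _ + _ _; rewrite !(mul0r, mulr0, addr0, add0r) => E.
have yy : y * y^* = 1 by rewrite -normCK y1 expr1n.
have /eqP : (x - y) * M 0 1 = 0.
  have -> : (x - y) * M 0 1 = y * (x * M 0 1 * y^*) - y * M 0 1 by ring: yy.
  by rewrite E subrr.
by rewrite mulf_eq0 subr_eq0 (negPf xy) => /eqP.
Qed.

(** For real p and q the two middle equations are conjugate to each other, so that three conditions
    remain. *)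
Lemma unitary_rel_mx2_diag (p q a b c d : C) :
  unitary_rel (mx2 p 0 0 q) (mx2 a b c d) <->
  [/\ p * `|a| ^+ 2 + q * `|b| ^+ 2 = p, a * p * c^* + b * q * d^* = 0,
      c * p * a^* + d * q * b^* = 0 & p * `|c| ^+ 2 + q * `|d| ^+ 2 = q].
Proof.
rewrite /unitary_rel mx2_adj !mx2M !(mulr0, addr0, add0r) !normCK !mulrA.
split=> [/mx2_inj[]|[]].
  by rewrite ![p * _]mulrC ![q * _]mulrC.
by rewrite ![p * _]mulrC ![q * _]mulrC => -> -> -> ->.
Qed.

(** The roots of unity enter only through their moduli and through [T != 1], which separates the
    eigenvalues of the image of tau. *)
Lemma unitary_repr_rel_rho3 (T t w c d : C)
    (rho : {ghom necklace_braid_group 3 -> GL C 2}) :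
  `|t| = 1 -> `|T| = 1 -> T != 1 -> `|w| = 1 -> d != 0 ->
  is_rho T t (w * d) c d rho ->
  (exists M : 'M[C]_2, hermitian_posdef M /\ unitary_repr_rel rho M) <->
  (`|d| < 1 /\ c = w * d * (`|d| ^+ 2 - 1) / d^*).
Proof.
move=> t1 T1 Tn1 w1 d0 [tauE sigE].
have nt : t != 0 by rewrite -normr_eq0 t1 oner_eq0.
have nT : T != 0 by rewrite -normr_eq0 T1 oner_eq0.
have nd : d^* != 0 by rewrite conjC_eq0.
have nw : w != 0 by rewrite -normr_eq0 w1 oner_eq0.
have ww : w * w^* = 1 by rewrite -normCK w1 expr1n.
have wd : `|w * d| ^+ 2 = `|d| ^+ 2 by rewrite normrM w1 mul1r.
split=> [[M [Mpos /unitary_repr_rel_presented MU]]|[d1 cE]].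
  have p0 := hermitian_posdef_diag _ _ 0 Mpos.
  have q0 := hermitian_posdef_diag _ _ 1 Mpos.
  have M01 : M 0 1 = 0.
    apply: (unitary_rel_diag_offdiag _ (T * t) t t1).
      by rewrite -subr_eq0 -{2}[t]mul1r -mulrBl mulf_neq0 // subr_eq0.
    by rewrite -tauE; apply: MU.
  have M10 : M 1 0 = 0.
    case: Mpos => /is_hermitianmxP /matrixP /(_ 1 0) + _.
    by rewrite !mxE M01 conjC0 mulr0.
  (* The index 0 stands for sigma_1, where the power of [T] is 1. Below, [E1] determines q and [E3]
     determines c. *)
  have := MU (Some 0); rewrite (mx2_eta _ M) M01 M10.
  move: (sigE 0); rewrite expr0 invr1 mulr1 => ->.
  case/unitary_rel_mx2_diag; rewrite wd normr1 expr1n mulr1 => E1 _ E3 _.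
  have qE : M 1 1 = M 0 0 * (1 - `|d| ^+ 2).
    by rewrite -[in LHS](addKr (M 0 0 * `|d| ^+ 2) (M 1 1)) E1; ring.
  split.
    (* Since p > 0, positivity of q = p (1 - |d|^2) amounts to |d| < 1. *)
    move: q0; rewrite qE pmulr_rgt0 // subr_gt0 -[X in _ < X](expr1n _ 2).
    by rewrite ltr_pXn2r ?nnegrE.
  have := E3; rewrite conjC1 qE mulr1 rmorphM /= => {}E3.
  have /(mulfI (lt0r_neq0 p0)) E :
      M 0 0 * (c * w^* * d^*) = M 0 0 * (d * (`|d| ^+ 2 - 1)).
    by apply/eqP; rewrite -subr_eq0 -E3; apply/eqP; ring.
  by apply: (mulIf nd); rewrite mulfVK // -mulrA -E; ring: ww.
have dd : `|d| ^+ 2 < 1 by rewrite -[X in _ < X](expr1n _ 2) ltr_pXn2r ?nnegrE.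
(* The form forced by the other direction, scaled so that p = 1. *)
exists (mx2 1 0 0 (1 - `|d| ^+ 2)); split.
  by apply: hermitian_posdef_mx2; rewrite ?ltr01 ?subr_gt0.
have conjN : (`|d| ^+ 2)^* = `|d| ^+ 2 by rewrite rmorphXn /= conj_normC.
(* Thus |c| = q, and the equation for the entry (1, 1) becomes q^2 + q |d|^2 = q. *)
have cN : `|c| = 1 - `|d| ^+ 2.
  rewrite cE !normrM normfV norm_conjC w1 mul1r mulrAC mulfV ?normr_eq0 //.
  by rewrite mul1r distrC ger0_norm // subr_ge0 ltW.
apply/unitary_repr_rel_presented => -[i|].
  rewrite [X in unitary_rel _ X]sigE; apply/unitary_rel_mx2_diag.
  have nz := expf_neq0 i nT; have z1 : `|T ^+ i| = 1 by rewrite normrX T1 expr1n.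
  (* All sigma_j are treated at once: the power of [T] becomes an arbitrary z of modulus 1. *)
  move: (T ^+ i) nz z1 => z nz z1.
  have zz : z^* = z^-1.
    by apply: (mulfI nz); rewrite -normCK z1 expr1n mulfV.
  have E : c * z^-1 * 1 * (w * d)^* + d * (1 - `|d| ^+ 2) * z^* = 0.
    rewrite zz cE rmorphM /=.
    have -> : w^* = w^-1 by apply: (mulfI nw); rewrite ww mulfV.
    by field; rewrite nw nz nd.
  split=> //.
  - by rewrite wd z1; ring.
  (* The equation for the entry (0, 1) is the conjugate of [E], the one for the entry (1, 0). *)
  - have /(congr1 Num.conj) := E.
    rewrite conjC0 !(rmorphD, rmorphM) /= rmorphN /= conjN !conjCK conjC1.
    by move=> <-; ring.
  - by rewrite normrM normfV z1 invr1 mulr1 cN; ring.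
rewrite [X in unitary_rel _ X]tauE; apply/unitary_rel_mx2_diag.
by rewrite normrM T1 t1 conjC0 normr0; split; ring.
Qed.

End Unitary.

Theorem proposition4p4 (R : realType) (t T w c d : R[i])
    (rho : {ghom necklace_braid_group 3 -> GL R[i] 2}) :
  6.-unity_root t ->
  T = expi (2 * pi / 3) \/ T = expi (- (2 * pi / 3)) ->
  w = expi (pi / 3) \/ w = expi (- (pi / 3)) ->
  d != 0 -> c != 0 -> c != w * d ^+ 2 ->
  is_rho T t (w * d) c d rho ->
  (exists M : 'M[R[i]]_2, hermitian_posdef M /\ unitary_repr_rel rho M) <->
  (`|d| < 1 /\ c = w * d * (`|d| ^+ 2 - 1) / d^*).
Proof.
move=> /unity_rootP t6 /expi_2pi3 T0 /expi_pi3 w0 d0 _ _ rhoE.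
have norm1 (x : R[i]) k : `|x ^+ k.+1| = 1 -> `|x| = 1.
  by move=> /eqP; rewrite normrX pexpr_eq1 // => /eqP.
apply: unitary_repr_rel_rho3 rhoE => //.
- by apply: (norm1 _ 5); rewrite t6 normr1.
(* T^3 - 1 = (T - 1)(T^2 + T + 1); likewise w^3 + 1 = (w + 1)(w^2 - w + 1) below. *)
- apply: (norm1 _ 2); rewrite (_ : T ^+ 3 = 1) ?normr1 //.
  by apply/eqP; rewrite -subr_eq0 -(mul0r (T - 1)) -T0; apply/eqP; ring.
(* At T = 1 the polynomial T^2 + T + 1 takes the value 3, which is nonzero. *)
- apply: contra_eqN T0 => /eqP ->.
  by rewrite expr1n (_ : _ + 1 = 3%:R) ?pnatr_eq0 //; ring.
- apply: (norm1 _ 2); rewrite (_ : w ^+ 3 = -1) ?normrN1 //.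
  by apply/eqP; rewrite -addr_eq0 -(mul0r (w + 1)) -w0; apply/eqP; ring.
Qed.
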